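(* Let $L$ be a Leibniz algebra over a field $\mathbb{K}$. The centralizers $C_L(x)$ are (two-sided) ideals of $L$ for all $x\in L$ if and only if $L$ is a CL-algebra.
   Context: A Leibniz algebra over a field $\mathbb{K}$ is a $\mathbb{K}$-vector space $L$ with a $\mathbb{K}$-bilinear bracket $[\cdot,\cdot]:L\times L\to L$ satisfying $[x,[y,z]]=[[x,y],z]-[[x,z],y]$ for all $x,y,z\in L$. The centralizer of $x\in L$ is $C_L(x)=\{y\in L\mid [x,y]=0=[y,x]\}$. A linear subspace $P\subseteq L$ is an ideal if $[a,y]\in P$ and $[y,a]\in P$ for all $a\in L$, $y\in P$. $L$ is a left CL-algebra if $[[x,a],y]=0$ and $[[a,x],y]=0$ for all $a,x\in L$ and all $y\in C_L(x)$. $L$ is a right CL-algebra if $[[x,a],y]=0$ and $[y,[a,x]]=0$ for all $a,x\in L$ and all $y\in C_L(x)$. $L$ is a CL-algebra if it is both a left and a right CL-algebra. *)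

(* Defs.v *)
From mathcomp Require Import all_boot all_algebra.

Set Implicit Arguments.
Unset Strict Implicit.
Unset Printing Implicit Defensive.

Import GRing.Theory.
Local Open Scope ring_scope.

Section LeibnizAlgebra.

(* [L] may be infinite-dimensional: [lmodType K] is any K-vector space. *)
Variables (K : fieldType) (L : lmodType K) (br : {bilinear L -> L -> L}).

Local Notation "[[ x , y ]]" := (br x y) (at level 0).

(* Right Leibniz algebras: each map [a |-> br a z] is a derivation. *)
Definition leibniz_identity : Prop :=
  forall x y z : L, [[x, [[y, z]]]] = [[[[x, y]], z]] - [[[[x, z]], y]].

Definition centralizer (x : L) : {pred L} :=
  [pred y | ([[x, y]] == 0) && ([[y, x]] == 0)].

Definition is_ideal (P : {pred L}) : Prop :=
  submod_closed P /\
  forall a y : L, y \in P -> [[a, y]] \in P /\ [[y, a]] \in P.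

Definition left_CL : Prop :=
  forall a x y : L, y \in centralizer x ->
    [[[[x, a]], y]] = 0 /\ [[[[a, x]], y]] = 0.

(* Not the mirror image of [left_CL]: only the second bracket is reversed. *)
Definition right_CL : Prop :=
  forall a x y : L, y \in centralizer x ->
    [[[[x, a]], y]] = 0 /\ [[y, [[a, x]]]] = 0.

Definition is_CL : Prop := left_CL /\ right_CL.

End LeibnizAlgebra.

(* Main.v *)
Require Import Defs.
From mathcomp Require Import all_boot all_algebra.
Import GRing.Theory.
Local Open Scope ring_scope.

(** Commuting to zero is symmetric: [y] centralizes [x] iff [x] centralizes [y] ([centralizer_sym]).
    So ideal closure of the centralizer of [y], applied to its member [x], yields the CL identities.
    Conversely, the left CL identities for both orders of the pair kill every product needed except
    those with [x] on the left of a bracket, and the Leibniz identity expands these into products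
    already zero. *)

Lemma centralizerP (K : fieldType) (L : lmodType K)
    (br : {bilinear L -> L -> L}) (x y : L) :
  reflect (br x y = 0 /\ br y x = 0) (y \in centralizer br x).
Proof. by rewrite inE; apply: (iffP andP) => -[/eqP ? /eqP ?]. Qed.

Lemma centralizer_sym (K : fieldType) (L : lmodType K)
    (br : {bilinear L -> L -> L}) (x y : L) :
  (y \in centralizer br x) = (x \in centralizer br y).
Proof. by rewrite !inE andbC. Qed.

Lemma centralizer_submod_closed (K : fieldType) (L : lmodType K)
    (br : {bilinear L -> L -> L}) (x : L) :
  submod_closed (centralizer br x).
Proof.
split=> [|a u v /centralizerP [xu ux] /centralizerP [xv vx]];
  apply/centralizerP; first by rewrite linear0r linear0l.
by rewrite linearPr linearPl xu ux xv vx scaler0 addr0.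
Qed.

Theorem corollary3p12 (K : fieldType) (L : lmodType K)
    (br : {bilinear L -> L -> L}) (hL : leibniz_identity br) :
  (forall x : L, is_ideal br (centralizer br x)) <-> is_CL br.
Proof.
split=> [idealC | [lCL _] x].
  have CL a x y : y \in centralizer br x ->
      [/\ br (br x a) y = 0, br (br a x) y = 0 & br y (br a x) = 0].
    (* The ideal used is the centralizer of [y], not of [x]: it absorbs [[a, x]] and [[x, a]]. *)
    rewrite centralizer_sym => /((idealC y).2 a).
    by case=> /centralizerP [? ?] /centralizerP [? ?].
  by split=> a x y /(CL a) [].
split=> [|a y yCx]; first exact: centralizer_submod_closed.
have [xy _] := centralizerP _ _ _ _ _ yCx.
have [xay _] := lCL a x y yCx.
(* With the roles of [x] and [y] exchanged, left CL gives [[[y, a], x] = [[a, y], x] = 0]. *)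
rewrite centralizer_sym in yCx.
have [yax ayx] := lCL a y x yCx.
(* Both [[x, [a, y]]] and [[x, [y, a]]] equal, up to sign, [[[x, a], y] - [[x, y], a]]. *)
by split; apply/centralizerP; split=> //; rewrite hL xy xay linear0l subrr.
Qed.
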